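(* Let $\chi$ be an $m\times n$ matrix over the sign hyperfield $\mathbb{S}$ (a sign pattern), and let $\mathrm{sign}:\mathbb{R}\to\mathbb{S}$ be the natural map. If the generalized number of sign changes of each row of $\chi$ is less than $k$, then $r(\mathrm{sign}^{-1}(\chi))\le k$; i.e., there exists a real matrix $A$ with sign pattern $\chi$ (meaning $\mathrm{sign}(A_{ij})=\chi_{ij}$ for all $i,j$) such that $\mathrm{rank}(A)\le k$.
   Context: $\mathbb{S}=\{0,1,-1\}$, and $\mathrm{sign}:\mathbb{R}\to\mathbb{S}$ sends a real number to its sign. $r(\mathrm{sign}^{-1}(\chi))$ denotes the minimum rank of a real matrix $A$ with $\mathrm{sign}(A)=\chi$ entrywise. For $X\in\{1,-1\}^n$, the number of sign changes of $X$ is the number of $i\in\{1,\dots,n-1\}$ with $X_i\neq X_{i+1}$. For $V\in\{0,1,-1\}^n$, let $V^+=\{i:V_i=1\}$ and $V^-=\{i:V_i=-1\}$; the generalized number of sign changes $\sigma(V)$ is the maximal number of sign changes of a vector $X\in\{1,-1\}^n$ with $V^+\subseteq X^+$ and $V^-\subseteq X^-$. *)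

(* Defs.v *)
From HB Require Import structures.
From mathcomp Require Import all_boot all_order all_algebra.
From mathcomp Require Import boolp classical_sets reals.

Set Implicit Arguments.
Unset Strict Implicit.
Unset Printing Implicit Defensive.

Import Order.TTheory GRing.Theory Num.Theory.

Local Open Scope ring_scope.
Local Open Scope classical_set_scope.

(* The underlying set {0, 1, -1} of the sign hyperfield; the hyperfield
   operations play no role for sign patterns and their realizations. *)
Inductive signS := S0 | S1 | SN1.

Definition signS_encode (s : signS) : option bool :=
  match s with S0 => None | S1 => Some true | SN1 => Some false end.

Definition signS_decode (o : option bool) : signS :=
  match o with None => S0 | Some true => S1 | Some false => SN1 end.

Lemma signS_encodeK : cancel signS_encode signS_decode.
Proof. by case. Qed.

HB.instance Definition _ := Finite.copy signS (can_type signS_encodeK).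

Definition sign (R : realType) (x : R) : signS :=
  if x == 0 then S0 else if 0 < x then S1 else SN1.

Section SignChanges.
Variable n : nat.
Implicit Types V X : 'rV[signS]_n.

Definition pos_part V : {set 'I_n} := [set i | V ord0 i == S1]%SET.
Definition neg_part V : {set 'I_n} := [set i | V ord0 i == SN1]%SET.

Definition is_pm1 X : bool := [forall i, X ord0 i != S0].

(* The existence of j with value i.+1 expresses that i is not the last index. *)
Definition sign_changes X : nat :=
  #|[set i : 'I_n | [exists j : 'I_n,
       (nat_of_ord j == i.+1) && (X ord0 i != X ord0 j)]]%SET|.

(* The range of the maximum is never empty: replacing the zeros of V by ones
   gives an admissible X. *)
Definition gen_sign_changes V : nat :=
  \max_(X : 'rV[signS]_n | [&& is_pm1 X, pos_part V \subset pos_part X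
                               & neg_part V \subset neg_part X])
    sign_changes X.

End SignChanges.

Section MinRank.
Variables (R : realType) (m n : nat).

Definition sign_preimage (chi : 'M[signS]_(m, n)) : set 'M[R]_(m, n) :=
  [set A | forall i j, sign (A i j) = chi i j].

Lemma sign_preimage_neq0 (chi : 'M[signS]_(m, n)) : sign_preimage chi !=set0.
Proof.
exists (map_mx (fun s => match s with S0 => 0 | S1 => 1 | SN1 => -1 end) chi).
move=> i j; rewrite mxE /sign; case: (chi i j); first by rewrite eqxx.
  by rewrite oner_eq0 ltr01.
by rewrite oppr_eq0 oner_eq0 oppr_gt0 ltr10.
Qed.

Lemma rank_in_ex (T : set 'M[R]_(m, n)) :
  T !=set0 -> exists r : nat, `[< exists2 A, T A & \rank A = r >].
Proof. by case=> A TA; exists (\rank A); apply/asboolP; exists A. Qed.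

Definition min_rank (T : set 'M[R]_(m, n)) (T0 : T !=set0) : nat :=
  ex_minn (rank_in_ex T0).

End MinRank.

(* Main.v *)
(** Each row is realized by the values at [0, 1, ..., n - 1] of a polynomial of
    degree at most its generalized number of sign changes, hence of degree less
    than [k]; the resulting matrix factors through a Vandermonde matrix with [k]
    rows. For a nonzero row [V], fix an index [j0] with [V j0 != 0] and fill in
    the zeros of [V] moving away from [j0], each zero receiving the sign opposite
    to its neighbour on the side of [j0]. A polynomial with one root for each
    sign change of this filling has the right signs, provided the root of a
    change caused by a zero of [V] is put at that zero, and every other root
    strictly between the two neighbours. *)

Require Import Defs.
From mathcomp Require Import all_boot all_order all_algebra.
From mathcomp Require Import boolp classical_sets reals.
From mathcomp Require Import zify lra.

Set Implicit Arguments.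
Unset Strict Implicit.
Unset Printing Implicit Defensive.

Import Order.TTheory GRing.Theory Num.Theory.

Local Open Scope ring_scope.

(* In the fillings, [true] stands for the sign -1. *)
Fixpoint fill_right (V : nat -> signS) (j : nat) : bool :=
  match V j, j with
  | S1, _ => false
  | SN1, _ => true
  | S0, 0 => false
  | S0, i.+1 => ~~ fill_right V i
  end.

(** Both branches read [V] outward from [j0], so one recursion serves both directions. *)
Definition fill (V : nat -> signS) (j0 j : nat) : bool :=
  if (j0 <= j)%N then fill_right (fun i => V (j0 + i)%N) (j - j0)
  else fill_right (fun i => V (j0 - i)%N) (j0 - j).

Lemma fill_rightE V j : V j != S0 -> fill_right V j = (V j == SN1).
Proof. by case: j => [|j] /=; case: (V _). Qed.

Lemma fillE V j0 j : V j != S0 -> fill V j0 j = (V j == SN1).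
Proof.
move=> Vj; rewrite /fill; case: leqP => jj0.
  by rewrite fill_rightE subnKC.
by rewrite fill_rightE subKn // ltnW.
Qed.

Lemma fill_zero_right V j0 j :
  (j0 <= j)%N -> V j.+1 = S0 -> fill V j0 j.+1 = ~~ fill V j0 j.
Proof.
move=> jj0 Vj; rewrite /fill jj0 (leqW jj0) subSn //=.
by rewrite -subSn // subnKC ?Vj // leqW.
Qed.

Lemma fill_zero_left V j0 j :
  V j0 != S0 -> (j < j0)%N -> V j = S0 -> fill V j0 j = ~~ fill V j0 j.+1.
Proof.
move=> Vj0 jj0 Vj; rewrite /fill leqNgt jj0 /=.
have -> : (j0 - j)%N = (j0 - j.+1).+1 by lia.
rewrite [LHS]/=; have -> : (j0 - (j0 - j.+1).+1)%N = j by lia.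
(* For [j.+1 = j0] the two sides use different branches of [fill], which agree at [j0]. *)
rewrite Vj; case: leqP => // j0j.
have -> : j.+1 = j0 by lia.
by rewrite subnn /= addn0 subn0.
Qed.

Section SignPolynomial.
Variable R : realType.

Definition sign_val (s : signS) : R :=
  match s with S0 => 0 | S1 => 1 | SN1 => -1 end.

Lemma sign_sg (x : R) (s : signS) : Num.sg x = sign_val s -> sign x = s.
Proof.
rewrite /sign; case: sgrP => _; case: s => //= e; exfalso; lra.
Qed.

(** A zero causing a change between [i] and [i.+1] is the endpoint farther from [j0], hence the two
    cases. *)
Definition change_root (V : nat -> signS) (j0 i : nat) : R :=
  if (j0 <= i)%N then (if V i.+1 == S0 then i.+1%:R else i%:R + 2^-1)
  else (if V i == S0 then i%:R else i%:R + 2^-1).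

(** The root lies between [i] and [i.+1] and is an endpoint only where [V] vanishes, so it is never
    [j]. *)
Lemma sg_sub_change_root V j0 i j : V j != S0 ->
  Num.sg (j%:R - change_root V j0 i) = if (j <= i)%N then -1 else 1.
Proof.
move=> Vj; case: leqP => ij.
  apply/ltr0_sg; rewrite subr_lt0.
  have ijR : j%:R <= i%:R :> R by rewrite ler_nat.
  have iS : i.+1%:R = i%:R + 1 :> R by rewrite -natr1.
  rewrite /change_root; case: ifP => _; case: ifP => [/eqP Vi|_]; try lra.
  rewrite ltr_nat ltn_neqAle ij andbT.
  by apply: contra Vj => /eqP ->; rewrite Vi.
apply/gtr0_sg; rewrite subr_gt0.
have ijR : i.+1%:R <= j%:R :> R by rewrite ler_nat.
have iS : i.+1%:R = i%:R + 1 :> R by rewrite -natr1.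
rewrite /change_root; case: ifP => _; case: ifP => [/eqP Vi|_]; try lra.
rewrite ltr_nat ltn_neqAle ij andbT.
by apply: contra Vj => /eqP <-; rewrite Vi.
Qed.

(** Each change at or after [j] contributes -1, and the parity of their number tells whether [X j]
    and [X n] differ. *)
Lemma prod_sign_changes (X : nat -> bool) (n j : nat) : (j <= n)%N ->
  \prod_(i < n | X i != X i.+1) (if (j <= i)%N then -1 else 1)
    = (-1) ^+ (X j (+) X n) :> R.
Proof.
elim: n => [|n IHn]; first by rewrite leqn0 => /eqP ->; rewrite big_ord0 addbb.
rewrite big_mkcond big_ord_recr -big_mkcond /= leq_eqVlt ltnS => /orP[/eqP ->|jn].
  rewrite ltnn addbb if_same mulr1 big1 // => i _.
  by rewrite leqNgt ltnS ltnW.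
rewrite jn IHn //.
by case: (X j) (X n) (X n.+1) => [] [] [] /=; rewrite ?expr0 ?expr1; lra.
Qed.

(** No root exceeds [n], so the leading coefficient takes the sign of the filling at [n]. *)
Definition sign_poly (V : nat -> signS) (j0 n : nat) : {poly R} :=
  (-1) ^+ fill V j0 n
    *: \prod_(i < n | fill V j0 i != fill V j0 i.+1)
         ('X - (change_root V j0 i)%:P).

Lemma size_sign_poly V j0 n :
  size (sign_poly V j0 n)
    = #|[pred i : 'I_n | fill V j0 i != fill V j0 i.+1]|.+1.
Proof.
rewrite size_scale ?signr_eq0 // -big_filter.
by have [e _ _ [_ <-]] := big_enumP; rewrite size_prod_XsubC.
Qed.

Lemma sign_sign_poly V j0 n j : V j0 != S0 -> (j0 <= n)%N -> (j <= n)%N ->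
  sign (sign_poly V j0 n).[j%:R] = V j.
Proof.
move=> Vj0 j0n jn; apply: sign_sg.
rewrite /sign_poly hornerZ horner_prod.
case: (eqVneq (V j) S0) => [Vj|Vj].
  (* The filling changes between [j] and its neighbour towards [j0], and the root of this change is
     [j]. *)
  rewrite Vj; apply/eqP; rewrite sgr_eq0 mulf_eq0; apply/orP; right.
  apply/prodf_eq0; case: (ltngtP j j0) => [jj0|j0j|jj0].
  - exists (Ordinal (leq_trans jj0 j0n)) => /=.
      by rewrite (fill_zero_left Vj0 jj0 Vj); case: (fill _ _ _).
    by rewrite hornerXsubC /change_root leqNgt jj0 /= Vj eqxx subrr.
  - case: j j0j jn Vj => // i j0i i_lt_n Vi.
    exists (Ordinal i_lt_n) => /=.
      by rewrite (@fill_zero_right V j0 i j0i Vi); case: (fill _ _ _).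
    by rewrite hornerXsubC /change_root -ltnS j0i Vi eqxx subrr.
  - by rewrite -jj0 Vj eqxx in Vj0.
rewrite sgrM sgrX sgrN1 (big_morph _ (@sgrM R) (@sgr1 R)).
under eq_bigr do rewrite hornerXsubC sg_sub_change_root //.
(* The sign at [n] occurs in the leading coefficient and in the product, and cancels. *)
rewrite prod_sign_changes // (fillE j0 Vj) addbC signr_addb mulrA -expr2 sqrr_sign.
by rewrite mul1r; case: (V j) Vj.
Qed.

End SignPolynomial.

Lemma card_changes_le n (V : 'rV[signS]_n.+1) (X : nat -> bool) :
  (forall i, V ord0 i != S0 -> X i = (V ord0 i == SN1)) ->
  (#|[pred i : 'I_n | X i != X i.+1]| <= gen_sign_changes V)%N.
Proof.
move=> VX.
pose x : 'rV[signS]_n.+1 := \row_i (if X i then SN1 else S1).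
have x_adm : [&& is_pm1 x, pos_part V \subset pos_part x
                         & neg_part V \subset neg_part x].
  apply/and3P; split.
  - by apply/forallP => i; rewrite mxE; case: (X i).
  - by apply/fintype.subsetP => i; rewrite !inE mxE => /eqP Vi; rewrite VX Vi.
  - by apply/fintype.subsetP => i; rewrite !inE mxE => /eqP Vi; rewrite VX Vi.
rewrite /gen_sign_changes (bigD1 x x_adm) /=; apply: leq_trans (leq_maxl _ _).
(* Changes are indexed here by ['I_n], but in [sign_changes] by ['I_n.+1]. *)
have widen_inj : injective (widen_ord (leqnSn n)).
  by move=> i j /(congr1 val) /= ij; apply: val_inj.
rewrite -(card_image widen_inj) /sign_changes.
apply/subset_leq_card/fintype.subsetP => _ /fintype.imageP[i Xi ->].
rewrite !inE in Xi *; apply/existsP; exists (lift ord0 i).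
rewrite !mxE /= eqxx /=.
by move: Xi; rewrite /bump /= add1n; case: (X i) (X i.+1) => [] [].
Qed.

Lemma sign_vector_poly (R : realType) n (V : 'rV[signS]_n) :
  exists2 p : {poly R}, (size p <= (gen_sign_changes V).+1)%N
    & forall j : 'I_n, sign p.[j%:R] = V ord0 j.
Proof.
case: (pickP (fun j => V ord0 j != S0)) => [j0 Vj0|V0]; last first.
  exists 0 => [|j]; first by rewrite size_poly0.
  by rewrite horner0 /sign eqxx (eqP (negbFE (V0 j))).
case: n V j0 Vj0 => [|n] V j0 Vj0; first by case: j0 {Vj0}.
(* Beyond [n], [inord] defaults to index 0; only indices up to [n] are read. *)
pose W j := V ord0 (inord j).
have WE (j : 'I_n.+1) : W j = V ord0 j by rewrite /W inord_val.
exists (sign_poly R W j0 n) => [|j].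
  rewrite size_sign_poly ltnS; apply: card_changes_le => i Vi.
  by rewrite fillE WE.
by rewrite sign_sign_poly ?WE // -ltnS.
Qed.

Theorem theorem4p22 (R : realType) (m n k : nat) (chi : 'M[signS]_(m, n)) :
  (forall i : 'I_m, (gen_sign_changes (row i chi) < k)%N) ->
  (min_rank (sign_preimage_neq0 R chi) <= k)%N /\
  (exists A : 'M[R]_(m, n),
     (forall (i : 'I_m) (j : 'I_n), sign (A i j) = chi i j) /\
     (\rank A <= k)%N).
Proof.
move=> chi_lt_k.
have [A signA rankA] : exists2 A : 'M[R]_(m, n),
    (forall i j, sign (A i j) = chi i j) & (\rank A <= k)%N.
  have /choice[p pP] : forall i : 'I_m, exists p : {poly R},
      (size p <= k)%N /\ forall j : 'I_n, sign p.[j%:R] = chi i j.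
    move=> i; have [p sz_p sign_p] := sign_vector_poly R (row i chi).
    exists p; split=> [|j]; first exact: leq_trans sz_p (chi_lt_k i).
    by rewrite sign_p mxE.
  (* Since [p i] has at most [k] coefficients, the product evaluates it at [j]; the inner dimension
     [k] bounds the rank. *)
  exists ((\matrix_(i < m, l < k) (p i)`_l)
            *m Vandermonde k (\row_(j < n) j%:R)); last exact: mulmx_max_rank.
  move=> i j; have [sz_p <-] := pP i.
  rewrite mxE (horner_coef_wide _ sz_p); congr sign.
  by apply: eq_bigr => l _; rewrite !mxE.
split; last by exists A.
rewrite /min_rank; case: ex_minnP => r _ r_min.
by apply: leq_trans rankA; apply: r_min; apply/asboolP; exists A.
Qed.
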